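(* Fix $\varepsilon>0$ and $\gamma\in(0,1)$, and let $d_N=(1-\gamma)\sqrt{\frac{\log N}{2\log\log N}}$. Let $n\in\mathbb{N}$, $G=\mathbb{Z}_2^n$ and $N=2^n=|G|$, and let $d$ be an integer with $2\leqslant d\leqslant d_N$. If $\Gamma\in\mathcal{G}(G,p)$ with $p\leqslant\sqrt[d]{d!(1-\varepsilon)\frac{\log N}{N^{d-1}}}$, then with high probability the diameter of $\Gamma$ is greater than $d$; that is, $\Pr(\operatorname{diam}(\Gamma)\leqslant d)\to0$ as $n\to\infty$, uniformly over all such $d$ and $p$.
   Context: For a group $G$ and a subset $S\subseteq G$, the (undirected) Cayley graph $\Gamma(G;S)$ has vertex set $G$ and an edge between $g\neq h$ iff $g^{-1}h\in S$ or $h^{-1}g\in S$ (loops and multiple edges ignored). The model $\mathcal{G}(G,p)$ is the probability space of Cayley graphs $\Gamma(G;S)$ where each element of $G$ is put in $S$ independently with probability $p$. The diameter of a disconnected graph is infinite. *)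

(* Defs.v *)
From HB Require Import structures.
From mathcomp Require Import all_boot all_order all_algebra.
From mathcomp Require Import all_classical all_reals all_analysis.
Set Implicit Arguments. Unset Strict Implicit. Unset Printing Implicit Defensive.
Import Order.TTheory GRing.Theory Num.Theory.
Local Open Scope ring_scope.

Definition cayley_adj (G : finZmodType) (S : {set G}) (g h : G) : bool :=
  (g != h) && ((- g + h \in S) || (- h + g \in S)).

Fixpoint dist_le (G : finZmodType) (S : {set G}) (k : nat) (x y : G) : bool :=
  match k with
  | O => x == y
  | k'.+1 => dist_le S k' x y || [exists z, dist_le S k' x z && cayley_adj S z y]
  end.

(* diam(Gamma(G;S)) <= d  (a disconnected graph has infinite diameter,
   so it never satisfies this). *)
Definition diam_le (G : finZmodType) (S : {set G}) (d : nat) : bool :=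
  [forall x : G, [forall y : G, dist_le S d x y]].

(* Probability, in the model G(G,p), that the random S satisfies P:
   each element of G is put in S independently with probability p. *)
Definition prob_Gp (R : realType) (G : finZmodType) (p : R)
    (P : {set G} -> bool) : R :=
  \sum_(S : {set G} | P S) p ^+ #|S| * (1 - p) ^+ (#|G| - #|S|)%N.

(* Main.v *)
Require Import Defs.
From HB Require Import structures.
From mathcomp Require Import all_boot all_order all_algebra.
From mathcomp Require Import all_classical all_reals all_analysis.
From mathcomp Require Import ring lra zify.
Import Order.TTheory GRing.Theory Num.Theory.
Set Implicit Arguments.
Unset Strict Implicit.
Unset Printing Implicit Defensive.
Local Open Scope ring_scope.

(* Second moment method.  In characteristic two, [g] is within distance [d] of
   [0] iff some [T \subset S] with [#|T| <= d] has sum [g].  Let [X] be the number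
   of nonzero [g] without such a [T], and [mu g] the expected number of such [T].
   A [T] of size [k] is determined by [k - 1] of its elements, hence
   [mu g <= (1 - eps) log N + o(1)].  Harris' inequality gives
   [P(g uncovered) >= exp(- mu g / (1 - p))], so that E X tends to infinity, and
   a form of Janson's inequality gives
   [P(g, h uncovered) <= exp(- (1 - eta) (mu g + mu h))].  The overlap term [eta]
   is at most [2^(d+1) d d! (log N) N^(-1/d)], which is [o(1 / log N)] as soon as
   [2 d^2 log log N <= log N]; therefore Var X = o((E X)^2). *)

(** * Random subsets *)

Section RandomSubset.
Context {R : realType} {V : finType}.
Variable p : R.
Hypothesis p01 : 0 <= p <= 1.
Implicit Types (s : seq V) (f g : {set V} -> R) (S T : {set V}).

Lemma set0_subset_seq s : (finset.set0 : {set V}) \subset s.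
Proof. by apply/fintype.subsetP => y; rewrite finset.in_set0. Qed.

(* Exposing the elements of [s] one at a time turns Harris' inequality and
   independence into inductions on [s]. *)
Fixpoint expect s f : R :=
  if s is x :: s' then
    p * expect s' (fun S => f (x |: S)) + (1 - p) * expect s' f
  else f finset.set0.

(** Sorting the subsets of [x :: s] by whether they contain [x] reproduces the recursion of
    [expect]. This links it to the product weights of [prob_Gp]. *)
Lemma expect_sum s f : uniq s ->
  expect s f = \sum_(S : {set V} | S \subset s)
                 p ^+ #|S| * (1 - p) ^+ (size s - #|S|)%N * f S.
Proof.
elim: s f => [|x s IH] f /=.
  move=> _; rewrite (big_pred1 finset.set0) ?cards0 ?mul1r // => S /=.
  apply/idP/eqP => [/fintype.subsetP sS|->]; last exact: set0_subset_seq.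
  by apply/setP => y; rewrite finset.in_set0; apply/negP => /sS.
case/andP=> xs us; rewrite !IH //
  [RHS](bigID (fun S => x \in S)) /=.
have szS S : S \subset s -> (#|S| <= size s)%N.
  move=> Ss; rewrite -(card_uniqP us); exact: subset_leq_card.
have xS S : S \subset s -> x \notin S.
  by move=> /fintype.subsetP Ss; apply: contra xs => /Ss.
congr (_ + _).
  rewrite [RHS](reindex_onto (fun S => x |: S) (fun S => S :\ x)) /=; last first.
    by move=> S /andP[_ xS']; rewrite finset.setD1K.
  rewrite mulr_sumr; apply: eq_big => S.
    apply/idP/idP => [Ss|].
      rewrite setU11 finset.setU1K ?xS // eqxx !andbT.
      apply/fintype.subsetP => y; rewrite !inE => /orP[->//|yS].
      by rewrite (fintype.subsetP Ss) ?orbT.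
    case/andP=> /andP[/fintype.subsetP Ss _] /eqP xS'.
    have nx : x \notin S by rewrite -xS' !inE eqxx.
    apply/fintype.subsetP => y yS; have := Ss y; rewrite !inE yS orbT => /(_ isT).
    by case/orP => // /eqP yx; rewrite -yx yS in nx.
  by move=> Ss; rewrite cardsU1 xS //= add1n subSS exprS !mulrA.
rewrite mulr_sumr; apply: eq_big => S.
  apply/idP/idP => [Ss|].
    rewrite xS // andbT; apply/fintype.subsetP => y yS.
    by rewrite inE (fintype.subsetP Ss) ?orbT.
  case/andP=> /fintype.subsetP Ss nx; apply/fintype.subsetP => y yS.
  have := Ss y yS; rewrite inE => /orP[/eqP yx|//].
  by rewrite -yx yS in nx.
by move=> Ss; rewrite subSn ?szS // exprS; ring.
Qed.

Lemma eq_expect s f g : (forall S, S \subset s -> f S = g S) ->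
  expect s f = expect s g.
Proof.
elim: s f g => [|x s IH] f g fg /=; first by rewrite fg // set0_subset_seq.
congr (_ * _ + _ * _); apply: IH => S Ss; apply: fg; last first.
  by apply/fintype.subsetP => y yS; rewrite inE (fintype.subsetP Ss) ?orbT.
apply/fintype.subsetP => y; rewrite !inE => /orP[->//|yS].
by rewrite (fintype.subsetP Ss) ?orbT.
Qed.

Lemma expectD s f g : expect s (fun S => f S + g S) = expect s f + expect s g.
Proof. by elim: s f g => [|x s IH] f g //=; rewrite !IH; ring. Qed.

Lemma expectZ s c f : expect s (fun S => c * f S) = c * expect s f.
Proof. by elim: s f => [|x s IH] f //=; rewrite !IH; ring. Qed.

Lemma expectN s f : expect s (fun S => - f S) = - expect s f.
Proof. by elim: s f => [|x s IH] f //=; rewrite !IH; ring. Qed.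

Lemma expectB s f g : expect s (fun S => f S - g S) = expect s f - expect s g.
Proof. by rewrite expectD expectN. Qed.

Lemma expect_const s (c : R) : expect s (fun=> c) = c.
Proof. by elim: s => [|x s IH] //=; rewrite !IH; ring. Qed.

Lemma expect_big (I : Type) (r : seq I) (P : pred I) s (f : I -> {set V} -> R) :
  expect s (fun S => \sum_(i <- r | P i) f i S) =
  \sum_(i <- r | P i) expect s (f i).
Proof.
elim: r => [|i r IH].
  rewrite big_nil -[RHS](expect_const s 0).
  by apply: eq_expect => S _; rewrite big_nil.
rewrite big_cons; case: ifP => Pi.
  rewrite -IH -expectD; apply: eq_expect => S _.
  by rewrite big_cons Pi.
by rewrite -IH; apply: eq_expect => S _; rewrite big_cons Pi.
Qed.

Lemma expect_le s f g : (forall S, f S <= g S) -> expect s f <= expect s g.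
Proof.
elim: s f g => [|x s IH] f g fg //=.
by case/andP: p01 => p0 p1; apply: lerD; apply: ler_wpM2l;
  rewrite ?subr_ge0 //; apply: IH.
Qed.

Lemma expect_ge0 s f : (forall S, 0 <= f S) -> 0 <= expect s f.
Proof. by move=> f0; rewrite -(expect_const s 0); apply: expect_le. Qed.

Lemma harris s f g :
  (forall S S', S \subset S' -> f S <= f S') ->
  (forall S S', S \subset S' -> g S <= g S') ->
  expect s f * expect s g <= expect s (fun S => f S * g S).
Proof.
elim: s f g => [|x s IH] f g fm gm //=.
have up (h : {set V} -> R) : (forall S S', S \subset S' -> h S <= h S') ->
    expect s h <= expect s (fun S => h (x |: S)).
  by move=> hm; apply: expect_le => S; apply: hm; apply: finset.subsetUr.
have addm (h : {set V} -> R) : (forall S S', S \subset S' -> h S <= h S') ->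
    forall S S', S \subset S' -> h (x |: S) <= h (x |: S').
  by move=> hm S S' SS; apply: hm; apply: finset.setUS.
have /= H1 := IH _ _ (addm f fm) (addm g gm).
have H0 := IH _ _ fm gm.
have fx := up _ fm; have gx := up _ gm.
move: H1 H0 fx gx.
set a1 := expect s (fun S => f _); set b1 := expect s (fun S => g (x |: S)).
set c1 := expect s (fun S => f _ * _); set c0 := expect s (fun S => f S * _).
set a0 := expect s f; set b0 := expect s g => H1 H0 fx gx.
case/andP: p01 => p0 p1.
(* This covariance is exactly the gap between the average of the products [a1 * b1], [a0 * b0] and
   the product of the averages. *)
have Hp : 0 <= p * (1 - p) * ((a1 - a0) * (b1 - b0)).
  by rewrite !mulr_ge0 ?subr_ge0.
have := ler_wpM2l p0 H1; have := @ler_wpM2l _ (1 - p) _ _ _ H0.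
rewrite subr_ge0 => /(_ p1); nra.
Qed.

Lemma harris_anti s f g :
  (forall S S', S \subset S' -> f S <= f S') ->
  (forall S S', S \subset S' -> g S' <= g S) ->
  expect s (fun S => f S * g S) <= expect s f * expect s g.
Proof.
move=> fm gm; rewrite -lerN2 -mulrN -!expectN.
under [leRHS]eq_expect do rewrite -mulrN.
by apply: harris => // S S' SS; rewrite lerN2 gm.
Qed.

Lemma harris_decr s f g :
  (forall S S', S \subset S' -> f S' <= f S) ->
  (forall S S', S \subset S' -> g S' <= g S) ->
  expect s f * expect s g <= expect s (fun S => f S * g S).
Proof.
move=> fm gm; rewrite -lerN2 -mulNr -!expectN.
under [leLHS]eq_expect do rewrite -mulNr.
by apply: harris_anti => // S S' SS; rewrite lerN2 fm.
Qed.

(** The hypothesis on [g] says that it ignores the elements of [T]. Exposing an element of [T]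
    therefore only contributes a factor [p], and exposing any other element leaves both factors to
    the induction. *)
Lemma expect_indep s T g : uniq s -> T \subset s ->
  (forall x S, x \in T -> g (x |: S) = g S) ->
  expect s (fun S => (T \subset S)%:R * g S) = p ^+ #|T| * expect s g.
Proof.
elim: s T g => [|x s IH] T g /=.
  move=> _ T0 _; have -> : T = finset.set0.
    apply/setP => y; rewrite finset.in_set0; apply/negP.
    by move/(fintype.subsetP T0).
  by rewrite finset.sub0set cards0.
case/andP=> xs us Txs gT; have [xT|xT] := boolP (x \in T).
  have Ts : T :\ x \subset s.
    apply/fintype.subsetP => y; rewrite !inE => /andP[yx yT].
    by have := fintype.subsetP Txs y yT; rewrite inE (negbTE yx).
  rewrite (_ : expect s (fun S => (T \subset S)%:R * g S) = 0); last first.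
    rewrite -(expect_const s 0); apply: eq_expect => S Ss.
    case: (boolP (T \subset S)) => [TS|]; last by rewrite mul0r.
    by rewrite (fintype.subsetP Ss) // (fintype.subsetP TS) in xs.
  have -> : expect s (fun S => (T \subset x |: S)%:R * g (x |: S)) =
            expect s (fun S => (T :\ x \subset S)%:R * g S).
    apply: eq_expect => S Ss; rewrite gT // -finset.subDset.
    by [].
  have -> : expect s (fun S => g (x |: S)) = expect s g.
    by apply: eq_expect => S Ss; rewrite gT.
  rewrite IH //; last by move=> y S; rewrite !inE => /andP[_ yT]; rewrite gT.
  by rewrite (cardsD1 x T) xT add1n exprS; ring.
have Ts : T \subset s.
  apply/fintype.subsetP => y yT; have := fintype.subsetP Txs y yT.
  by rewrite inE => /orP[/eqP yx|//]; rewrite -yx yT in xT.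
have -> : expect s (fun S => (T \subset x |: S)%:R * g (x |: S)) =
          expect s (fun S => (T \subset S)%:R * g (x |: S)).
  apply: eq_expect => S Ss; congr (_%:R * _).
  rewrite -finset.subDset (_ : T :\ x = T) //.
  by apply/finset.setDidPl; rewrite disjoint_sym disjoints1.
rewrite (IH T (fun S => g (x |: S))) // ?(IH T g) //; last first.
  by move=> y S yT; rewrite finset.setUCA gT.
by ring.
Qed.

End RandomSubset.

(** * Janson's inequality *)

Lemma ler_sum_sub (R : numDomainType) (I : finType) (P Q : pred I) (f : I -> R) :
  (forall i, P i -> Q i) -> (forall i, Q i -> 0 <= f i) ->
  \sum_(i | P i) f i <= \sum_(i | Q i) f i.
Proof.
move=> PQ f0; rewrite big_mkcond [leRHS]big_mkcond; apply: ler_sum => i _.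
by case: ifP => [/PQ ->//|_]; case: ifP => // /f0.
Qed.

Section Janson.
Context {R : realType} {V : finType}.
Variable p : R.
Hypothesis p01 : 0 <= p <= 1.
Implicit Types (S T : {set V}) (F : {set {set V}}).

Local Notation E := (expect p (enum V)).

Definition avoids F S : bool := [forall T in F, ~~ (T \subset S)].

Lemma subset_enum S : S \subset enum V.
Proof. by apply/fintype.subsetP => x _; rewrite mem_enum. Qed.

Lemma avoids_anti F S S' :
  S \subset S' -> (avoids F S')%:R <= (avoids F S)%:R :> R.
Proof.
move=> SS; rewrite ler_nat; case: (boolP (avoids F S')) => // /forall_inP aF.
rewrite (_ : avoids F S = true) //; apply/forall_inP => T TF.
by apply: contra (aF T TF) => /fintype.subset_trans; apply.
Qed.

Lemma avoidsU F F' S : avoids (F :|: F') S = avoids F S && avoids F' S.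
Proof.
apply/forall_inP/andP => [aF|[/forall_inP aF /forall_inP aF'] T].
  by split; apply/forall_inP => T TF; apply: aF; rewrite inE TF ?orbT.
by rewrite inE => /orP[/aF|/aF'].
Qed.

Lemma avoids1 T S : avoids [set T] S = ~~ (T \subset S).
Proof.
apply/forall_inP/idP => [|TS T']; first by apply; rewrite inE.
by rewrite inE => /eqP->.
Qed.

Lemma subset_mono T S S' :
  S \subset S' -> (T \subset S)%:R <= (T \subset S')%:R :> R.
Proof.
move=> SS; rewrite ler_nat; case: (boolP (T \subset S)) => // TS.
by rewrite (fintype.subset_trans TS SS).
Qed.

Lemma expect_subset T : E (fun S => (T \subset S)%:R) = p ^+ #|T|.
Proof.
have := @expect_indep R V p (enum V) T (fun=> 1) (enum_uniq _) (subset_enum T).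
rewrite expect_const mulr1 => <- //.
by apply: eq_expect => S _; rewrite mulr1.
Qed.

(** The members of [F] disjoint from [T] form [F1], and avoiding [F1] is independent of
    [T \subset S]. Each member meeting [T] is charged by a union bound, where Harris' inequality
    gives the extra factor [p ^+ #|T' :\: T|]. *)
Lemma janson_step F T (eta : R) :
  eta <= 1 ->
  \sum_(T' in F | ~~ [disjoint T' & T]) p ^+ #|T' :\: T| <= eta ->
  E (fun S => (avoids (T |: F) S)%:R) <=
  (1 - (1 - eta) * p ^+ #|T|) * E (fun S => (avoids F S)%:R).
Proof.
move=> eta1 Heta.
have p0 : 0 <= p by case/andP: p01.
pose F1 := [set T' in F | [disjoint T' & T]].
have avF S : avoids F S -> avoids F1 S.
  move=> /forall_inP aF; apply/forall_inP => T'.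
  by rewrite inE => /andP[/aF].
have -> : E (fun S => (avoids (T |: F) S)%:R) =
    E (fun S => (avoids F S)%:R) - E (fun S => (T \subset S)%:R * (avoids F S)%:R).
  rewrite -expectB; apply: eq_expect => S _; rewrite avoidsU avoids1.
  by case: (T \subset S); case: (avoids F S); rewrite /= ?(mul0r, mul1r, subrr, subr0).
rewrite mulrBl mul1r lerD2l lerN2.
have indep : E (fun S => (T \subset S)%:R * (avoids F1 S)%:R) =
    p ^+ #|T| * E (fun S => (avoids F1 S)%:R).
  apply: expect_indep; [exact: enum_uniq|exact: subset_enum|].
  move=> x S xT; congr (nat_of_bool _)%:R; apply: eq_forallb_in => T'.
  rewrite inE => /andP[_ dT]; rewrite -finset.subDset (_ : T' :\ x = T') //.
  by apply/finset.setDidPl; rewrite disjoint_sym disjoints1 (disjointFl dT xT).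
have EF1 : E (fun S => (avoids F S)%:R) <= E (fun S => (avoids F1 S)%:R).
  apply: expect_le => // S; rewrite ler_nat.
  by case: (boolP (avoids F S)) => // /avF ->.
have F10 : 0 <= E (fun S => (avoids F1 S)%:R) by apply: expect_ge0.
apply: (@le_trans _ _ ((1 - eta) * p ^+ #|T| * E (fun S => (avoids F1 S)%:R))).
  by rewrite ler_wpM2l // mulr_ge0 ?exprn_ge0 // subr_ge0.
apply: (@le_trans _ _ (E (fun S => (T \subset S)%:R * (avoids F1 S)%:R) -
   \sum_(T' in F | ~~ [disjoint T' & T])
      E (fun S => (T :|: T' \subset S)%:R * (avoids F1 S)%:R))).
  rewrite indep.
  apply: (@le_trans _ _ (p ^+ #|T| * E (fun S => (avoids F1 S)%:R) -
     \sum_(T' in F | ~~ [disjoint T' & T])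
      p ^+ #|T' :\: T| * (p ^+ #|T| * E (fun S => (avoids F1 S)%:R)))).
    rewrite -mulr_suml -[X in _ <= X - _]mul1r -mulrBl -mulrA.
    by rewrite ler_wpM2r ?mulr_ge0 ?exprn_ge0 // lerD2l lerN2.
  rewrite lerD2l lerN2; apply: ler_sum => T' _.
  apply: le_trans (harris_anti _ _ _ _) _ => //.
  - exact: subset_mono.
  - exact: avoids_anti.
  rewrite expect_subset mulrA ler_wpM2r // -exprD.
  rewrite (_ : #|T :|: T'| = (#|T' :\: T| + #|T|)%N) //.
  rewrite -(finset.cardsID T (T :|: T')) finset.setUK addnC.
  by rewrite finset.setDUl finset.setDv finset.set0U.
rewrite -expect_big -expectB; apply: expect_le => // S.
case: (boolP (T \subset S)) => TS; last first.
  rewrite !mul0r sub0r oppr_le0; apply: sumr_ge0 => T' _.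
  by rewrite mulr_ge0.
rewrite !mul1r; case: (boolP (avoids F S)) => [aF|].
  by rewrite avF // lerBlDr lerDl; apply: sumr_ge0 => T' _; rewrite mulr1.
case: (boolP (avoids F1 S)) => aF1 aF; last first.
  by rewrite sub0r oppr_le0; apply: sumr_ge0 => T' _; rewrite mulr0.
(* [S] avoids [F1], so a member of [F] inside [S] must meet [T]; its summand then cancels the 1. *)
move: aF; rewrite negb_forall_in => /exists_inP[T' TF]; rewrite negbK => TS'.
rewrite (bigD1 T') /=; last first.
  rewrite TF /=; apply: contraL TS' => dT.
  by move: aF1 => /forall_inP/(_ T'); rewrite inE TF dT => /(_ isT).
rewrite finset.subUset TS TS' /= mulr1 opprD addrA subrr sub0r oppr_le0.
by apply: sumr_ge0 => ? _; rewrite mulr1.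
Qed.

(* Removing a member of least size first, no remaining member is contained in
   it, so only the overlaps [T' :\: T != set0] enter the correction [eta]. *)
Lemma janson F (eta : R) : 0 <= eta <= 1 ->
  (forall T, T \in F ->
    \sum_(T' in F | ~~ [disjoint T' & T] && ~~ (T' \subset T))
       p ^+ #|T' :\: T| <= eta) ->
  E (fun S => (avoids F S)%:R) <=
  expR (- ((1 - eta) * \sum_(T in F) p ^+ #|T|)).
Proof.
move=> /andP[eta0 eta1]; have p0 : 0 <= p by case/andP: p01.
have [m] := ubnP #|F|; elim: m F => // m IH F.
have [->|[T0 T0F]] := set_0Vmem F.
  move=> _ _; rewrite big_set0 mulr0 oppr0 expR0 -[leRHS](expect_const p (enum V) 1).
  by apply: expect_le => // S; rewrite lern1 leq_b1.
have [T TF Tmin] : exists2 T, T \in F & forall T', T' \in F -> (#|T| <= #|T'|)%N.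
  by case: (arg_minnP (fun T => #|T|) T0F) => T TF Tmin; exists T.
rewrite ltnS => sF HF.
have TFD : T \notin F :\ T by rewrite !inE eqxx.
have step := @janson_step (F :\ T) T eta eta1.
rewrite finset.setD1K // in step.
apply: le_trans (step _) _.
  apply: le_trans (HF T TF).
  apply: ler_sum_sub => [T'|*]; last exact: exprn_ge0.
  rewrite !inE => /andP[/andP[T'T T'F] ->]; rewrite T'F /=.
  apply: contra T'T => sT; rewrite eqEcard sT; exact: Tmin.
have IHF := IH (F :\ T) _ _.
rewrite (big_setD1 T TF) /= mulrDr opprD expRD ler_pM //.
- rewrite subr_ge0 mulr_ile1 ?subr_ge0 ?exprn_ge0 ?gerBl // exprn_ile1 //.
  by case/andP: p01.
- exact: expect_ge0.
- exact: expR_ge1Dx.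
apply: IHF; first by move: sF; rewrite (cardsD1 T F) TF.
move=> T' /setD1P[_ T'F]; apply: le_trans (HF T' T'F).
apply: ler_sum_sub => [U|*]; last exact: exprn_ge0.
by rewrite !inE -andbA => /andP[_].
Qed.

(** By Harris' inequality the decreasing events of missing each [T] are positively correlated, so
    their probabilities [1 - p ^+ #|T|] multiply to a lower bound. Nonemptiness gives
    [p ^+ #|T| <= p], whence the common denominator [1 - p]. *)
Lemma avoids_ge F : p < 1 -> (forall T, T \in F -> T != finset.set0) ->
  expR (- ((\sum_(T in F) p ^+ #|T|) / (1 - p))) <=
  E (fun S => (avoids F S)%:R).
Proof.
move=> p1; have p0 : 0 <= p by case/andP: p01.
have [m] := ubnP #|F|; elim: m F => // m IH F.
have [->|[T TF]] := set_0Vmem F.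
  move=> _ _; rewrite big_set0 mul0r oppr0 expR0 -[leLHS](expect_const p (enum V) 1).
  apply: expect_le => // S; rewrite (_ : avoids _ _ = true) //.
  by apply/forall_inP => T; rewrite inE.
rewrite ltnS => sF HF.
rewrite (big_setD1 T TF) /= mulrDl opprD expRD.
have -> : E (fun S => (avoids F S)%:R) =
    E (fun S => (~~ (T \subset S))%:R * (avoids (F :\ T) S)%:R).
  apply: eq_expect => S _.
  by rewrite -{1}(finset.setD1K TF) avoidsU avoids1 -natrM mulnb.
apply: le_trans (harris_decr _ _ _ _) => //; first last.
- exact: avoids_anti.
- move=> S S' /(@subset_mono T); rewrite !ler_nat.
  by case: (T \subset S); case: (T \subset S').
apply: ler_pM; rewrite ?expR_ge0 //; last first.
  apply: IH; first by move: sF; rewrite (cardsD1 T F) TF.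
  by move=> T' /setD1P[_ /HF].
have -> : E (fun S => (~~ (T \subset S))%:R) = 1 - p ^+ #|T|.
  rewrite -expect_subset -[X in X - _](expect_const p (enum V) 1) -expectB.
  by apply: eq_expect => S _; case: (T \subset S); rewrite /= ?subrr ?subr0.
have T0 : (0 < #|T|)%N by rewrite card_gt0 HF.
have pT : p ^+ #|T| <= p.
  by rewrite -(prednK T0) exprS ler_piMr // exprn_ile1 // ltW.
rewrite expRN -[leRHS]invrK lef_pV2 ?posrE ?expR_gt0 ?invr_gt0 ?subr_gt0 //; last first.
  exact: le_lt_trans pT p1.
apply: le_trans (expR_ge1Dx _).
have q1 : 0 < 1 - p by rewrite subr_gt0.
have x1 : 0 < 1 - p ^+ #|T| by rewrite subr_gt0; apply: le_lt_trans pT p1.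
(* With [t = p ^+ #|T|], the identity [1 / (1 - t) = 1 + t / (1 - t)] turns the bound on [1 - t]
   into [1 + u <= expR u]. *)
apply: (@le_trans _ _ (1 + p ^+ #|T| / (1 - p ^+ #|T|))).
  by rewrite le_eqVlt; apply/orP; left; apply/eqP; field; rewrite lt0r_neq0.
rewrite lerD2l ler_wpM2l ?exprn_ge0 // lef_pV2 ?posrE // lerD2l lerN2.
exact: pT.
Qed.

End Janson.

(** * Subset sums and the second moment *)

Lemma ler_sum_inj (R : numDomainType) (I J : finType) (P : pred I) (Q : pred J)
    (h : I -> J) (f : J -> R) :
  {in P &, injective h} -> (forall i, P i -> Q (h i)) ->
  (forall j, 0 <= f j) ->
  \sum_(i | P i) f (h i) <= \sum_(j | Q j) f j.
Proof.
move=> hinj PQ f0; rewrite -(big_imset f hinj) /=.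
by apply: ler_sum_sub => // j /imsetP[i iP ->]; apply: PQ.
Qed.

(** Chebyshev's inequality for the number [Z] of events that occur: if [Z = 0] then
    [(Z - m) ^+ 2 = m * m]. In the second moment the diagonal contributes at most [m], and the
    remaining pairs at most [c * (m * m)]. *)
Lemma second_moment (R : realType) (V I : finType) (p c : R) (A : {pred I})
    (D : I -> {set V} -> bool) :
  let E := expect p (enum V) in
  let m := \sum_(i in A) E (fun S => (D i S)%:R) in
  0 <= p <= 1 -> 0 <= c -> 0 < m ->
  {in A &, forall i j, i != j ->
    E (fun S => (D i S)%:R * (D j S)%:R) <=
    c * (E (fun S => (D i S)%:R) * E (fun S => (D j S)%:R))} ->
  E (fun S => [forall i in A, ~~ D i S]%:R) <= m^-1 + (c - 1).
Proof.
move=> E m p01 c0 m0 HD.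
pose Z S : R := \sum_(i in A) (D i S)%:R.
have EZ : E Z = m by rewrite /E /Z expect_big.
have EZ2 : E (fun S => Z S * Z S) <= m + c * (m * m).
  have -> : E (fun S => Z S * Z S) = \sum_(i in A) \sum_(j in A)
      E (fun S => (D i S)%:R * (D j S)%:R).
    rewrite /E; under eq_bigr do rewrite -expect_big.
    rewrite -expect_big; apply: eq_expect => S _.
    by rewrite /Z mulr_suml; apply: eq_bigr => i _; rewrite mulr_sumr.
  rewrite {3}/m mulr_suml mulr_sumr /m -big_split /=.
  apply: ler_sum => i iA; rewrite mulr_sumr mulr_sumr (bigD1 i) //=.
  have ED0 j : 0 <= E (fun S => (D j S)%:R) by apply: expect_ge0.
  apply: lerD.
    by apply: expect_le => // S; case: (D i S); rewrite ?mulr0 ?mulr1.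
  rewrite [leRHS](bigD1 i) //= ler_wpDl ?mulr_ge0 //.
  by apply: ler_sum => j /andP[jA ji]; apply: HD; rewrite // eq_sym.
have key : m * m * E (fun S => [forall i in A, ~~ D i S]%:R) <=
    m + c * (m * m) - m * m.
  apply: (@le_trans _ _ (E (fun S => (Z S * Z S - 2 * m * Z S) + m * m))).
    rewrite /E -expectZ; apply: expect_le => // S.
    case: (boolP [forall i in A, _]) => [/forall_inP DS|_].
      rewrite /Z big1 ?mulr0 ?mulr1 ?subrr ?add0r // => i iA.
      by rewrite (negbTE (DS i iA)).
    by rewrite mulr0 (_ : _ + _ = (Z S - m) ^+ 2) ?sqr_ge0 //; ring.
  rewrite /E expectD expectB expectZ expect_const -/E EZ.
  by move: EZ2; lra.
have mm : 0 < m * m by rewrite mulr_gt0.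
rewrite -(ler_pM2l mm); apply: le_trans key _.
by rewrite le_eqVlt; apply/orP; left; apply/eqP; field; rewrite gt_eqF.
Qed.

Lemma prob_Gp_expect (R : realType) (G : finZmodType) (p : R) (P : {set G} -> bool) :
  prob_Gp p P = expect p (enum G) (fun S => (P S)%:R).
Proof.
rewrite expect_sum ?enum_uniq // /prob_Gp big_mkcond /=.
rewrite [RHS]big_mkcond /=; apply: eq_bigr => S _.
by rewrite subset_enum -cardE; case: (P S); rewrite ?mulr1 ?mulr0.
Qed.

Section SubsetSums.
Variable G : finZmodType.
Implicit Types (S T : {set G}) (g s x y : G).

Definition set_sum T : G := \sum_(x in T) x.

Definition sets_with_sum k s : {set {set G}} :=
  [set T : {set G} | (#|T| == k) && (set_sum T == s)].

Lemma set_sumD1 T x : x \in T -> set_sum T = x + set_sum (T :\ x).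
Proof. by move=> xT; rewrite /set_sum (big_setD1 x). Qed.

Lemma set_sumID T I : set_sum T = set_sum (T :&: I) + set_sum (T :\: I).
Proof. by rewrite /set_sum (big_setID I). Qed.

(* A [k.+1]-set with sum [s] is determined by any [k] of its elements. *)
Lemma card_sets_with_sum k s : (k.+1`! * #|sets_with_sum k.+1 s| <= #|G| ^ k)%N.
Proof.
have main : (k.+1 * #|sets_with_sum k.+1 s| <= 'C(#|G|, k))%N.
  (* Double counting of pointed sets: [(T, x)] maps to the [k]-set [T :\ x], injectively because the
     prescribed sum recovers [x]. *)
  pose P := [set u : {set G} * G | (u.1 \in sets_with_sum k.+1 s) && (u.2 \in u.1)].
  have <- : #|P| = (k.+1 * #|sets_with_sum k.+1 s|)%N.
    rewrite -sum1_card (eq_bigl (fun u : {set G} * G =>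
      (u.1 \in sets_with_sum k.+1 s) && (u.2 \in u.1))); last by move=> u; rewrite inE.
    rewrite -(pair_big_dep (mem (sets_with_sum k.+1 s))
      (fun T x => x \in T) (fun _ _ => 1%N)) /=.
    rewrite mulnC -sum_nat_const; apply: eq_bigr => T.
    by rewrite sum1_card inE => /andP[/eqP].
  rewrite -card_draws -(@card_in_imset _ _ (fun u : {set G} * G => u.1 :\ u.2)).
    apply: subset_leq_card; apply/fintype.subsetP => A /imsetP[[T x]].
    rewrite !inE /= => /andP[/andP[/eqP cT _] xT] ->.
    by move: cT; rewrite (cardsD1 x T) xT add1n => -[->].
  move=> [T x] [T' x']; rewrite !inE /=.
  move=> /andP[/andP[_ /eqP sT] xT] /andP[/andP[_ /eqP sT'] xT'] TT.
  have xx : x = x'.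
    by move: sT'; rewrite -sT (set_sumD1 xT) (set_sumD1 xT') TT => /addIr.
  by rewrite -(finset.setD1K xT) -(finset.setD1K xT') TT xx.
rewrite factS mulnAC; apply: leq_trans (leq_mul main (leqnn _)) _.
rewrite bin_ffact; elim: k {main} => [|k IH]; first by rewrite ffactn0.
by rewrite ffactnSr expnSr leq_mul ?leq_subr.
Qed.

(** [T] consists of the generators used an odd number of times along the path. In characteristic two
    a repeated generator cancels, so a step by an element already in [T] removes it. *)
Lemma dist_le_set_sum S k y : (forall x, x + x = 0) -> dist_le S k 0 y ->
  exists T : {set G}, [/\ T \subset S, (#|T| <= k)%N & set_sum T = y].
Proof.
move=> char2; have oppx x : - x = x by apply/eqP; rewrite eq_sym -addr_eq0 char2.
elim: k y => [|k IH] y /=.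
  move=> /eqP <-; exists finset.set0.
  by rewrite finset.sub0set cards0 /set_sum big_set0.
case/orP=> [/IH[T [TS cT sT]]|/existsP[z /andP[/IH[T [TS cT sT]]]]].
  by exists T; split=> //; apply: leqW.
case/andP=> _; rewrite !oppx [y + z]addrC orbb => uS.
have [uT|uT] := boolP (z + y \in T).
  exists (T :\ (z + y)); split.
  - exact: fintype.subset_trans (finset.subD1set _ _) TS.
  - exact: leqW (leq_trans (subset_leq_card (finset.subD1set _ _)) cT).
  - apply: (@addrI _ (z + y)); rewrite -set_sumD1 // sT.
    by rewrite -addrA char2 addr0.
exists ((z + y) |: T); split.
- by rewrite finset.subUset finset.sub1set uS.
- by rewrite cardsU1 uT.
- rewrite (@set_sumD1 _ (z + y)) ?setU11 // finset.setU1K // sT.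
  by rewrite addrAC char2 add0r.
Qed.

End SubsetSums.

(** * An explicit bound on the probability of small diameter for a fixed group *)

Section FiniteBound.
Context {R : realType} {G : finZmodType}.
Variables (p rho : R) (d : nat).
Hypothesis p01 : 0 <= p <= 1.
Local Notation N := (#|G|%:R : R).
Hypothesis rhoP : forall k, (0 < k < d)%N -> N ^+ k.-1 * p ^+ k <= rho.
Hypothesis rho0 : 0 <= rho.
Implicit Types (S T : {set G}) (g s : G).

Definition rep_sets s : {set {set G}} :=
  [set T : {set G} | (#|T| <= d)%N && (set_sum T == s)].

Let p0 : 0 <= p. Proof. by case/andP: p01. Qed.

Lemma sum_by_card s (w : nat -> R) :
  \sum_(T in rep_sets s) w #|T| =
  \sum_(k < d.+1) #|sets_with_sum k s|%:R * w k.
Proof.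
rewrite (partition_big (fun T : {set G} => inord #|T| : 'I_d.+1) xpredT) //=.
apply: eq_bigr => k _; rewrite -sumr_const mulr_suml.
apply: eq_big => [T|T].
  rewrite !inE; apply/idP/idP.
    move=> /andP[/andP[cT ->] /eqP <-].
    by rewrite inordK ?ltnS // eqxx.
  move=> /andP[/eqP cT ->]; rewrite cT -ltnS ltn_ord /=; apply/eqP.
  exact: inord_val.
rewrite !inE => /andP[/andP[cT _] /eqP <-].
by rewrite inordK ?ltnS // mul1r.
Qed.

(** [rho] thus controls the expected number of [k]-subsets of [S] with a prescribed sum, for every
    size strictly between 0 and [d]. *)
Lemma card_sets_with_sum_rho k s : (0 < k < d)%N ->
  #|sets_with_sum k s|%:R * p ^+ k <= rho.
Proof.
move=> kd; apply: le_trans (rhoP kd); rewrite ler_wpM2r ?exprn_ge0 //.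
case: k kd => // k _; rewrite -natrX ler_nat.
by apply: leq_trans (card_sets_with_sum k s); rewrite leq_pmull ?fact_gt0.
Qed.

Lemma sum_small_sets s :
  \sum_(T : {set G} | [&& (0 < #|T|)%N, (#|T| < d)%N & set_sum T == s]) p ^+ #|T|
  <= d%:R * rho.
Proof.
have -> : \sum_(T : {set G} | [&& (0 < #|T|)%N, (#|T| < d)%N & set_sum T == s])
            p ^+ #|T| =
    \sum_(T in rep_sets s) (if (0 < #|T| < d)%N then p ^+ #|T| else 0).
  rewrite big_mkcond [RHS]big_mkcond /=; apply: eq_bigr => T _; rewrite inE.
  case: (ltnP 0 #|T|) => /=; last by case: ifP.
  case: (ltnP #|T| d) => /= [/ltnW ->|]; last by case: ifP.
  by [].
rewrite (sum_by_card s (fun k => if (0 < k < d)%N then p ^+ k else 0)).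
rewrite big_ord_recr /= ltnn andbF mulr0 addr0.
rewrite mulr_natl -[in leRHS](card_ord d) -sumr_const; apply: ler_sum => k _.
by case: ifP => [/card_sets_with_sum_rho ->//|_]; rewrite mulr0.
Qed.

(** Size [d] gives the main term, each smaller positive size at most [rho], and the empty set is
    excluded because its sum is not [g]. *)
Lemma sum_rep_sets g : (0 < d)%N -> g != 0 ->
  \sum_(T in rep_sets g) p ^+ #|T| <= N ^+ d.-1 * p ^+ d / d`!%:R + d%:R * rho.
Proof.
move=> d0 g0; rewrite (sum_by_card g (fun k => p ^+ k)) big_ord_recr /= addrC.
apply: lerD.
  rewrite ler_pdivlMr ?ltr0n ?fact_gt0 // mulrAC ler_wpM2r ?exprn_ge0 //.
  rewrite -natrX -natrM ler_nat mulnC.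
  by have := card_sets_with_sum d.-1 g; rewrite prednK.
rewrite mulr_natl -[in leRHS](card_ord d) -sumr_const; apply: ler_sum => k _.
case: (posnP k) => [->|k0]; last by rewrite card_sets_with_sum_rho // k0 ltn_ord.
rewrite (_ : sets_with_sum 0 g = finset.set0) ?cards0 ?mul0r //.
apply/setP => T; rewrite !inE cards_eq0; apply/negP => /andP[/eqP ->].
by rewrite /set_sum big_set0 eq_sym (negbTE g0).
Qed.

(** Sort the sets [T'] by their trace [I] on [T], with at most [2 ^ d] choices. Given [I], the rest
    [T' :\: T] has prescribed sum, is nonempty since [T'] is not inside [T], and has fewer than [d]
    elements since [T'] meets [T]; so [sum_small_sets] applies. *)
Lemma sum_overlaps T s : (#|T| <= d)%N ->
  \sum_(T' in rep_sets s | ~~ [disjoint T' & T] && ~~ (T' \subset T))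
     p ^+ #|T' :\: T| <= 2 ^+ d * (d%:R * rho).
Proof.
move=> cT.
rewrite (partition_big (fun T' => T' :&: T) (mem (powerset T))) /=; last first.
  by move=> T' _; rewrite powersetE finset.subsetIr.
apply: (@le_trans _ _ (\sum_(I in powerset T) d%:R * rho)); last first.
  rewrite sumr_const card_powerset -[leLHS]mulr_natl natrX ler_wpM2r ?mulr_ge0 //.
  by rewrite ler_weXn2l // ler1n.
apply: ler_sum => I _; apply: le_trans (sum_small_sets (s - set_sum I)).
apply: (ler_sum_inj (h := fun T' => T' :\: T) (f := fun B => p ^+ #|B|)).
- move=> T1 T2; rewrite !unfold_in => /andP[_ /eqP I1] /andP[_ /eqP I2] TT.
  by rewrite -(finset.setID T1 T) -(finset.setID T2 T) I1 I2 TT.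
- move=> T' /andP[/and3P[]]; rewrite inE => /andP[cT' /eqP <-] dT sT /eqP <-.
  rewrite card_gt0 finset.setD_eq0 sT /=; apply/andP; split.
    apply: leq_trans cT'; rewrite -(cardsID T T') -ltnS -addSn.
    rewrite ltnS -[X in (X < _)%N]add0n ltn_add2r card_gt0.
    by rewrite finset.setI_eq0.
  by rewrite (set_sumID T' T) addrC addKr.
- by move=> B; rewrite exprn_ge0.
Qed.

(** [M] bounds every [mu g], which bounds the mean number of uncovered elements from below. [kappa]
    bounds the loss per element between the Harris and Janson exponents, so [second_moment] applies
    with [c = expR (2 * kappa)]. *)
Lemma prob_diam_le (M kappa : R) :
  (forall x : G, x + x = 0) -> (0 < d)%N -> (1 < #|G|)%N -> p < 1 ->
  2 ^+ d.+1 * (d%:R * rho) <= 1 ->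
  N ^+ d.-1 * p ^+ d / d`!%:R + d%:R * rho <= M ->
  M * (p / (1 - p) + 2 ^+ d.+1 * (d%:R * rho)) <= kappa ->
  prob_Gp p (fun S : {set G} => diam_le S d) <=
  ((N - 1) * expR (- (M / (1 - p))))^-1 + (expR (2 * kappa) - 1).
Proof.
move=> char2 d0 N1 p1; set eta := 2 ^+ d.+1 * _ => eta1 HM Hk.
have q0 : 0 < 1 - p by rewrite subr_gt0.
have eta0 : 0 <= eta by rewrite !mulr_ge0 ?exprn_ge0.
pose E := expect p (enum G).
pose mu g : R := \sum_(T in rep_sets g) p ^+ #|T|.
have mu0 g : 0 <= mu g by apply: sumr_ge0 => T _; rewrite exprn_ge0.
have muM g : g != 0 -> mu g <= M.
  by move=> g0; apply: le_trans (sum_rep_sets d0 g0) HM.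
have low g : g != 0 ->
    expR (- (mu g / (1 - p))) <= E (fun S => (avoids (rep_sets g) S)%:R).
  move=> g0; apply: avoids_ge => // T; rewrite inE => /andP[_ /eqP sT].
  by apply: contra g0 => /eqP T0; rewrite -sT T0 /set_sum big_set0.
have up g h : g != 0 -> h != 0 -> g != h ->
    E (fun S => (avoids (rep_sets g) S)%:R * (avoids (rep_sets h) S)%:R) <=
    expR (- ((1 - eta) * (mu g + mu h))).
  move=> g0 h0 gh.
  have gh0 T : T \in rep_sets g -> T \in rep_sets h -> False.
    by rewrite !inE => /andP[_ /eqP ->] /andP[_]; apply/negP.
  have -> : mu g + mu h = \sum_(T in rep_sets g :|: rep_sets h) p ^+ #|T|.
    rewrite -bigU /=; first by apply: eq_bigl => T; rewrite finset.in_setU.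
    rewrite disjoint_subset; apply/fintype.subsetP => T Tg.
    by apply/negP => /(gh0 T Tg).
  have -> : E (fun S => (avoids (rep_sets g) S)%:R * (avoids (rep_sets h) S)%:R) =
      E (fun S => (avoids (rep_sets g :|: rep_sets h) S)%:R).
    by apply: eq_expect => S _; rewrite avoidsU -natrM mulnb.
  apply: janson; rewrite ?eta0 ?eta1 // => T TF.
  have cT : (#|T| <= d)%N by move: TF; rewrite !inE => /orP[] /andP[].
  (* One overlap bound for each of the two families, which is why [eta] carries the exponent
     [d.+1]. *)
  have -> : eta = 2 ^+ d * (d%:R * rho) + 2 ^+ d * (d%:R * rho).
    by rewrite /eta exprS; ring.
  apply: le_trans (lerD (sum_overlaps g cT) (sum_overlaps h cT)).
  rewrite [leLHS]big_mkcond [X in _ <= X + _]big_mkcond /=.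
  rewrite [X in _ <= _ + X]big_mkcond -big_split /=; apply: ler_sum => T' _.
  rewrite finset.in_setU; case: (boolP (T' \in rep_sets g)) => Tg /=.
    case: ifP => _; last by rewrite add0r; case: ifP => //; rewrite exprn_ge0.
    by rewrite lerDl; case: ifP => //; rewrite exprn_ge0.
  by rewrite add0r.
pose m : R := \sum_(g in predC1 (0 : G)) E (fun S => (avoids (rep_sets g) S)%:R).
have m_ge : (N - 1) * expR (- (M / (1 - p))) <= m.
  have -> : N - 1 = #|predC1 (0 : G)|%:R.
    by rewrite cardC1 -subn1 natrB // ltnW.
  rewrite mulr_natl -sumr_const; apply: ler_sum => g g0.
  apply: le_trans (low g g0); rewrite ler_expR lerN2 ler_wpM2r ?muM //.
  by rewrite invr_ge0 ltW.
have N10 : 0 < N - 1 by rewrite subr_gt0 ltr1n.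
have b0 : 0 < (N - 1) * expR (- (M / (1 - p))) by rewrite mulr_gt0 ?expR_gt0.
have m0 : 0 < m by apply: lt_le_trans m_ge.
apply: (@le_trans _ _ (m^-1 + (expR (2 * kappa) - 1))); last first.
  by rewrite lerD2r lef_pV2 ?posrE.
apply: le_trans (second_moment (D := fun g => avoids (rep_sets g))
  (A := predC1 (0 : G)) p01 (expR_ge0 _) m0 _); last first.
  move=> g h g0 h0 gh; rewrite -/E.
  apply: le_trans (up g h g0 h0 gh) _.
  apply: (@le_trans _ _ (expR (2 * kappa) *
      (expR (- (mu g / (1 - p))) * expR (- (mu h / (1 - p)))))); last first.
    by rewrite ler_wpM2l ?expR_ge0 // ler_pM ?expR_ge0 // low.
  rewrite -!expRD ler_expR.
  have bnd u : u != 0 -> mu u / (1 - p) - (1 - eta) * mu u <= kappa.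
    move=> u0; apply: le_trans Hk.
    have -> : mu u / (1 - p) - (1 - eta) * mu u = mu u * (p / (1 - p) + eta).
      by field; rewrite gt_eqF.
    rewrite ler_wpM2r ?muM // addr_ge0 // divr_ge0 // ltW //.
  by have := bnd g g0; have := bnd h h0; lra.
rewrite prob_Gp_expect; apply: expect_le => // S; rewrite ler_nat.
case: (boolP (diam_le S d)) => // /forallP/(_ 0)/forallP dS.
rewrite (_ : [forall i in _, _] = true) //; apply/forall_inP => g g0.
have [T [TS cT sT]] := dist_le_set_sum char2 (dS g).
rewrite negb_forall_in; apply/exists_inP; exists T; last by rewrite negbK.
by rewrite inE cT sT eqxx.
Qed.

End FiniteBound.

(** * Estimates *)

Section Asymptotics.
Context {R : realType}.
Implicit Types (x p L : R) (d k : nat).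

(** Put [c = d! ln x] and let [Q] be the [d]-th root of [c * x]. The hypothesis says [x * p <= Q],
    so [(x * p) ^+ k / x] is at most [Q ^+ d.-1 / x = c / Q], while [Q] is at least the [d]-th root
    of [x]. *)
Lemma power_le_rho x p d k : 1 <= ln x -> (0 < k < d)%N -> 0 <= p -> 0 < x ->
  p ^+ d <= d`!%:R * ln x / x ^+ d.-1 ->
  x ^+ k.-1 * p ^+ k <= d`!%:R * ln x * expR (- (ln x / d%:R)).
Proof.
move=> L1 /andP[k0 kd] p0 x0 Hp.
have d0 : (0 < d)%N by apply: leq_trans kd.
have dR : (0 : R) < d%:R by rewrite ltr0n.
have f1 : (1 : R) <= d`!%:R by rewrite ler1n fact_gt0.
have c1 : 1 <= d`!%:R * ln x by apply: mulr_ege1.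
have c0 : 0 < d`!%:R * ln x by apply: lt_le_trans c1.
set c := d`!%:R * ln x in Hp c1 c0 *.
have cx0 : 0 < c * x by rewrite mulr_gt0.
pose Q := expR (ln (c * x) / d%:R).
have Q0 : 0 < Q by apply: expR_gt0.
have Qd : Q ^+ d = c * x.
  by rewrite -expRM_natl mulrC divfK ?gt_eqF // lnK.
have QL : expR (ln x / d%:R) <= Q.
  rewrite ler_expR ler_pM2r ?invr_gt0 // ler_ln ?posrE //.
  by rewrite ler_peMl // ltW.
have Q1 : 1 <= Q.
  apply: le_trans QL; rewrite -[leLHS]expR0 ler_expR divr_ge0 ?(ltW dR) // (le_trans _ L1) //.
have qQ : x * p <= Q.
  rewrite -(ler_pXn2r d0) ?nnegrE ?mulr_ge0 ?(ltW x0) ?(ltW Q0) // Qd exprMn.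
  rewrite -[d in x ^+ d](prednK d0) exprSr mulrAC ler_wpM2r ?(ltW x0) //.
  by rewrite mulrC -ler_pdivlMr ?exprn_gt0.
have -> : x ^+ k.-1 * p ^+ k = (x * p) ^+ k / x.
  rewrite exprMn -[in x ^+ k](prednK k0) exprSr; field; exact: lt0r_neq0.
rewrite ler_pdivrMr //; apply: (@le_trans _ _ (Q ^+ d.-1)).
  apply: (@le_trans _ _ (Q ^+ k)); first by rewrite lerXn2r ?nnegrE ?mulr_ge0 ?(ltW x0) ?(ltW Q0).
  by rewrite ler_weXn2l // -ltnS prednK.
have -> : Q ^+ d.-1 = c * x / Q.
  by rewrite -Qd -[in RHS](prednK d0) exprSr mulfK ?gt_eqF.
rewrite [leLHS]mulrAC ler_pM2r // ler_pM2l // expRN lef_pV2 ?posrE ?expR_gt0 //.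
Qed.

Lemma fact_pow_le d : (2 <= d)%N -> (2 ^ d * (d * d`!) <= d ^ (3 * d))%N.
Proof.
move=> d2; rewrite mulSn expnD mulSn expnD mul1n.
have fle m : (m`! <= m ^ m)%N.
  rewrite fact_prod big_add1 /= big_mkord -[X in (_ <= X)%N]/(m ^ m)%N.
  rewrite -[X in (m ^ X)%N](card_ord m) -prod_nat_const.
  by apply: leq_prod => i _.
apply: leq_mul; first by rewrite leq_exp2r //; lia.
apply: leq_mul; last exact: fle.
by rewrite -{1}(expn1 d) leq_pexp2l //; lia.
Qed.

(** The combinatorial factor is at most [expR (3 * d * ln d)]. With [y = L / d], the hypothesis
    gives [2 * d * ln L <= y] and [d <= sqrt L], so [3 * d * ln d] uses up at most three quarters of
    [y]; the remaining quarter is at least [sqrt L / 4]. *)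
Lemma eta_le L d : (2 <= d)%N -> 1 <= 2 * ln L -> 1 <= L ->
  2 * ln L * d%:R ^+ 2 <= L ->
  2 ^+ d.+1 * (d%:R * (d`!%:R * L * expR (- (L / d%:R)))) <=
  2 * L * expR (- (Num.sqrt L / 4)).
Proof.
move=> d2 l1 L1 HL.
have dR : (0 : R) < d%:R by rewrite ltr0n; lia.
have L0 : 0 < L by lra.
have dL : d%:R ^+ 2 <= L.
  by apply: le_trans HL; rewrite ler_peMl // exprn_ge0 // ltW.
have lnd : 2 * ln d%:R <= ln L.
  by rewrite mulr_natl -lnXn // ler_ln ?posrE ?exprn_gt0.
have -> : 2 ^+ d.+1 * (d%:R * (d`!%:R * L * expR (- (L / d%:R)))) =
    2 * L * ((2 ^ d * (d * d`!))%:R * expR (- (L / d%:R))).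
  by rewrite exprS !natrM natrX; ring.
rewrite ler_wpM2l ?mulr_ge0 ?(ltW L0) //.
apply: (@le_trans _ _ ((d ^ (3 * d))%:R * expR (- (L / d%:R)))).
  by rewrite ler_wpM2r ?expR_ge0 // ler_nat fact_pow_le.
have -> : (d ^ (3 * d))%:R = expR ((3 * d%:R) * ln d%:R) :> R.
  by rewrite -natrM expRM_natl lnK ?posrE // natrX.
rewrite -expRD ler_expR.
set y := L / d%:R.
have yd : y * d%:R = L by rewrite divfK // gt_eqF.
have y1 : 2 * ln L * d%:R <= y.
  by rewrite ler_pdivlMr // -[leLHS]mulrA -expr2.
have sd : d%:R <= Num.sqrt L.
  by rewrite -[leLHS]ger0_norm ?(ltW dR) // -sqrtr_sqr ler_sqrt ?(ltW L0).
have y2 : Num.sqrt L <= y.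
  rewrite ler_pdivlMr // -[leRHS](sqr_sqrtr (ltW L0)) expr2.
  by rewrite ler_wpM2l ?sqrtr_ge0.
have : d%:R * (2 * ln d%:R) <= d%:R * ln L by rewrite ler_wpM2l // ltW.
by lra.
Qed.

(** [expR (s / 4)] is the sixth power of [expR (s / 24)], hence at least [(s / 24) ^+ 6]. The sixth
    power of [s = sqrt L] is the cube of [L], so the bound still tends to 0 after multiplication by
    [L]. *)
Lemma expR_sqrt_le L : 0 < L ->
  2 * L * expR (- (Num.sqrt L / 4)) <= 2 * 24 ^+ 6 / L ^+ 2.
Proof.
move=> L0; set s := Num.sqrt L.
have s0 : 0 < s by rewrite sqrtr_gt0.
have sL : s ^+ 2 = L by rewrite sqr_sqrtr // ltW.
rewrite expRN.
have low : (s / 24) ^+ 6 <= expR (s / 4).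
  have -> : s / 4 = 6%:R * (s / 24) by field.
  rewrite expRM_natl lerXn2r ?nnegrE ?expR_ge0 ?divr_ge0 ?(ltW s0) //.
  by apply: le_trans (expR_ge1Dx _); rewrite lerDr.
have pos : 0 < (s / 24) ^+ 6 by rewrite exprn_gt0 // divr_gt0.
apply: (@le_trans _ _ (2 * L * ((s / 24) ^+ 6)^-1)).
  rewrite ler_wpM2l ?mulr_ge0 ?(ltW L0) // lef_pV2 ?posrE ?expR_gt0 //.
rewrite -sL le_eqVlt; apply/orP; left; apply/eqP.
by field; rewrite gt_eqF.
Qed.

End Asymptotics.

Unset Implicit Arguments.

(** * The asymptotic statement for binary vector spaces *)

Lemma rV_F2_addxx (n : nat) (x : 'rV['F_2]_n) : x + x = 0.
Proof. by apply/rowP => i; rewrite !mxE; apply: addrr_pchar2; rewrite pchar_Fp. Qed.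

Lemma card_rV_F2 (n : nat) : #|{: 'rV['F_2]_n}| = (2 ^ n)%N.
Proof. by rewrite card_mx card_Fp // mul1n. Qed.

Theorem theorem4 (R : realType) (eps gamma : R) :
  0 < eps -> 0 < gamma < 1 ->
  forall delta : R, 0 < delta ->
  exists n0 : nat, forall n : nat, (n0 <= n)%N ->
  forall (d : nat) (p : R),
    (2 <= d)%N ->
    d%:R <= (1 - gamma) * Num.sqrt (ln ((2 ^ n)%:R : R) / (2 * ln (ln ((2 ^ n)%:R : R)))) ->
    0 <= p <= 1 ->
    p ^+ d <= d`!%:R * (1 - eps) * ln ((2 ^ n)%:R : R) / ((2 ^ n)%:R : R) ^+ d.-1 ->
    prob_Gp p (fun S : {set 'rV['F_2]_n} => diam_le S d) <= delta.
Proof.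
move=> eps0 /andP[gamma0 gamma1] delta delta0.
(* [c] serves as [kappa]: the second entry gives [expR (2 * c) - 1 <= delta / 2], the first keeps
   the error terms below 1. *)
pose c : R := Num.min (1 / 2) (ln (1 + delta / 2) / 2).
have c0 : 0 < c.
  by rewrite lt_min divr_gt0 //= divr_gt0 // ln_gt0 // ltrDl divr_gt0.
pose C : R := 6 * (2 * 24 ^+ 6).
have C0 : 0 < C by rewrite !mulr_gt0 // exprn_gt0.
(* The entries ensure, in order, [1 <= ln L], a large enough mean, and
   [6 * L * eta <= C / L <= c]. *)
pose L0 : R := Num.max (expR 1) (Num.max (4 / (delta * eps)) (C / c)).
have ln20 : 0 < ln 2 :> R by rewrite ln_gt0 // ltr1n.
exists (Num.bound (L0 / ln 2)) => n n0n d p d2.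
have LE : ln ((2 ^ n)%:R : R) = n%:R * ln 2.
  by rewrite natrX lnXn // mulr_natl.
have LL0 : L0 <= ln ((2 ^ n)%:R : R).
  rewrite LE -ler_pdivrMr //; apply: le_trans (_ : (Num.bound (L0 / ln 2))%:R <= _).
    by rewrite ltW // archi_boundP // divr_ge0 ?(ltW ln20) // le_max expR_ge0.
  by rewrite ler_nat.
set x := ((2 ^ n)%:R : R) in LE LL0 *; set L := ln x in LE LL0 *.
have x0 : 0 < x by rewrite ltr0n expn_gt0.
have xL : x = expR L by rewrite lnK.
move: LL0; rewrite !ge_max => /and3P[Le Ld Lc] Hd /andP[p0 p1] Hp.
have e2 : (2 : R) <= expR 1 by apply: le_trans (expR_ge1Dx _); lra.
have L2 : 2 <= L by apply: le_trans Le.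
have L1 : 1 <= L by lra.
have Lpos : 0 < L by lra.
have l1 : 1 <= ln L by rewrite -[leLHS](expRK 1) ler_ln ?posrE ?expR_gt0.
have l0 : 0 < 2 * ln L by lra.
have dR : (0 : R) < d%:R by rewrite ltr0n; exact: ltnW d2.
(* The bound on [d], with [1 - gamma <= 1], squared. *)
have HL : 2 * ln L * d%:R ^+ 2 <= L.
  have ds : d%:R <= Num.sqrt (L / (2 * ln L)).
    apply: le_trans Hd _; rewrite ler_piMl ?sqrtr_ge0 //; lra.
  rewrite mulrC -ler_pdivlMr //.
  rewrite -[leRHS]sqr_sqrtr ?divr_ge0 ?(ltW l0) ?(ltW Lpos) //.
  by rewrite lerXn2r ?nnegrE ?sqrtr_ge0 ?(ltW dR).
pose rho := d`!%:R * L * expR (- (L / d%:R)).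
have rho0 : 0 <= rho by rewrite !mulr_ge0 ?expR_ge0 ?(ltW Lpos).
pose eta := 2 ^+ d.+1 * (d%:R * rho).
have d1 : (0 < d)%N by exact: ltnW d2.
have xd0 : 0 < x ^+ d.-1 by rewrite exprn_gt0.
have f0 : (0 : R) < d`!%:R by rewrite ltr0n fact_gt0.
have rhoP k : (0 < k < d)%N -> x ^+ k.-1 * p ^+ k <= rho.
  move=> kd; apply: power_le_rho => //; rewrite -/L //.
  apply: le_trans Hp _; rewrite ler_pM2r ?invr_gt0 // ler_pM2r //.
  by rewrite ler_piMr ?(ltW f0) //; lra.
(* The case [k = 1], admissible because [2 <= d], makes [p] itself small. *)
have p_rho : p <= rho by have := rhoP 1%N d2; rewrite expr0 expr1 mul1r.
have drho_eta : d%:R * rho <= eta.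
  apply: ler_peMl; first by rewrite mulr_ge0 ?(ltW dR).
  by apply: exprn_ege1; rewrite ler1n.
have rho_eta : rho <= eta.
  by apply: le_trans drho_eta; rewrite ler_peMl // ler1n.
have eta_C : 6 * L * eta <= c.
  have eta_L : eta <= 2 * 24 ^+ 6 / L ^+ 2.
    apply: le_trans (expR_sqrt_le Lpos).
    by apply: eta_le => //; lra.
  apply: (@le_trans _ _ (6 * L * (2 * 24 ^+ 6 / L ^+ 2))).
    by rewrite ler_pM2l // mulr_gt0.
  have -> : 6 * L * (2 * 24 ^+ 6 / L ^+ 2) = C / L.
    by rewrite /C; field; rewrite gt_eqF.
  by rewrite ler_pdivrMr // mulrC -ler_pdivrMr.
have c12 : c <= 1 / 2 by rewrite ge_min lexx.
have clog : 2 * c <= ln (1 + delta / 2).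
  have : c <= ln (1 + delta / 2) / 2 by rewrite ge_min lexx orbT.
  by lra.
have eta0 : 0 <= eta by apply: le_trans rho_eta.
have eta1 : 12 * eta <= 1 / 2.
  have : 6 * 2 * eta <= 6 * L * eta by rewrite ler_wpM2r // ler_wpM2l.
  by lra.
pose M := (1 - eps) * L + eta.
have pq : p / (1 - p) <= 2 * eta.
  rewrite ler_pdivrMr; last by lra.
  have : eta * p <= eta * (1 / 2) by rewrite ler_wpM2l //; lra.
  by lra.
have pq0 : 0 <= p / (1 - p) by rewrite divr_ge0 //; lra.
have ML : M <= 2 * L.
  have : 0 <= eps * L by rewrite mulr_ge0 ?ltW.
  by rewrite /M; lra.
(* Used for [y = p / (1 - p) + eta] and for [y = p / (1 - p)]; the 6 in [eta_C] is 2 from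
   [M <= 2 * L] times this 3. *)
have Mk y : 0 <= y <= 3 * eta -> M * y <= c.
  move=> /andP[y0 y1]; apply: (@le_trans _ _ (2 * L * y)).
    by rewrite ler_wpM2r.
  apply: le_trans eta_C; rewrite (_ : 6 * L * eta = 2 * L * (3 * eta)); last by ring.
  by rewrite ler_wpM2l // mulr_ge0 ?ltW.
have cardx : #|{: 'rV['F_2]_n}|%:R = x by rewrite card_rV_F2.
have n1 : (1 < #|{: 'rV['F_2]_n}|)%N.
  rewrite -(ltr_nat R) cardx xL; apply: lt_le_trans (expR_ge1Dx _); lra.
apply: (@le_trans _ _ (((x - 1) * expR (- (M / (1 - p))))^-1 + (expR (2 * c) - 1))).
  rewrite -cardx; apply: (@prob_diam_le _ _ p rho d).
  - by rewrite p0.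
  - by rewrite cardx.
  - by [].
  - exact: rV_F2_addxx.
  - by [].
  - by [].
  - by lra.
  - by rewrite -/eta; lra.
  - rewrite cardx /M lerD // ler_pdivrMr // mulrC -ler_pdivlMr //.
    by apply: le_trans Hp _; rewrite le_eqVlt; apply/orP; left; apply/eqP; ring.
  - by apply: Mk; rewrite -/eta; lra.
have secondb : expR (2 * c) - 1 <= delta / 2.
  have : expR (2 * c) <= 1 + delta / 2.
    rewrite -[leRHS]lnK ?posrE; first by rewrite ler_expR.
    by have := divr_gt0 delta0 (ltr0n R 2); lra.
  by lra.
have firstb : ((x - 1) * expR (- (M / (1 - p))))^-1 <= delta / 2.
  (* Dividing by [1 - p] costs at most [c], and [eta + c <= 1]. *)
  have Mp : M / (1 - p) <= (1 - eps) * L + 1.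
    have -> : M / (1 - p) = M + M * (p / (1 - p)).
      by field; rewrite gt_eqF //; lra.
    have : M * (p / (1 - p)) <= c by apply: Mk; lra.
    by rewrite /M; lra.
  have x1 : x / 2 <= x - 1.
    have : 1 + L <= x by rewrite xL; exact: expR_ge1Dx.
    by lra.
  (* Since [x = expR L], the mean is at least [expR (eps * L - 1) / 2], hence at least
     [eps * L / 2], and [L] exceeds [4 / (delta * eps)]. *)
  have low : 2 / delta <= (x - 1) * expR (- (M / (1 - p))).
    apply: (@le_trans _ _ (x / 2 * expR (- ((1 - eps) * L + 1)))); last first.
      by rewrite ler_pM ?expR_ge0 ?divr_ge0 ?(ltW x0) // ler_expR lerN2.
    have -> : x / 2 * expR (- ((1 - eps) * L + 1)) = expR (eps * L - 1) / 2.
      rewrite xL mulrAC -expRD; congr (expR _ / 2); ring.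
    rewrite ler_pdivlMr //; apply: le_trans (expR_ge1Dx _).
    have -> : 2 / delta * 2 = eps * (4 / (delta * eps)).
      by field; rewrite !gt_eqF.
    have : eps * (4 / (delta * eps)) <= eps * L by rewrite ler_pM2l.
    by lra.
  rewrite -[leRHS]invrK lef_pV2 ?posrE ?invf_div //.
    by apply: lt_le_trans low; rewrite divr_gt0.
  by rewrite divr_gt0.
by lra.
Qed.
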